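(* Let $q$ be a prime power, let $m\ge 1$, and let $S$ be a nonempty set of lattice points contained in the cube $K_q^m=[0,q-2]^m\subset\mathbb{R}^m$. Let $Y\subseteq\mathbb{R}^m$ be a coordinate subspace and let $\pi:\mathbb{R}^m\to Y$ be the corresponding coordinate projection. For $a\in\pi(S)$ let $S_a=S\cap\pi^{-1}(a)$ be the fiber of $S$ over $a$. Then $$d(S)\ \geq\ \min_{\emptyset\neq S'\subseteq \pi(S)}\left(d(S')\,\max_{a\in S'}d(S_a)\right).$$ Here $d(S')$ is computed with $S'$ viewed as a set of lattice points in $Y\cong\mathbb{R}^{\dim Y}$, and $d(S_a)$ is computed with $S_a$ viewed as a set of lattice points in $\mathbb{R}^{m-\dim Y}$, by dropping the coordinates belonging to $Y$ (which are constant on $S_a$).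
   Context: $\mathbb{F}_q$ is the finite field with $q$ elements and $\mathbb{F}_q^*=\mathbb{F}_q\setminus\{0\}$. For $r\ge 0$ let $K_q^r=[0,q-2]^r\subset\mathbb{R}^r$. For a nonempty set $A\subseteq K_q^r\cap\mathbb{Z}^r$, let $\mathcal{L}(A)=\operatorname{span}_{\mathbb{F}_q}\{t^a : a\in A\}$, where $t^a=t_1^{a_1}\cdots t_r^{a_r}$. The generalized toric code $\mathcal{C}_A$ is the image of the evaluation map $\mathcal{L}(A)\to\mathbb{F}_q^{(q-1)^r}$, $f\mapsto (f(p))_{p\in(\mathbb{F}_q^* )^r}$. This map is injective because $A\subseteq K_q^r$. The minimum distance $d(A)=d(\mathcal{C}_A)$ is the minimum weight (number of nonzero entries) of a nonzero codeword. Equivalently, it is the minimum over nonzero $f\in\mathcal{L}(A)$ of the number of points of $(\mathbb{F}_q^* )^r$ at which $f$ does not vanish. For $r=0$ the torus is a single point, and $d$ of the one-point set is $1$. A coordinate subspace of $\mathbb{R}^m$ is the span of a subset of the standard basis vectors; the corresponding projection keeps those coordinates and forgets the others. *)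

(* Defs.v *)
From HB Require Import structures.
From mathcomp Require Import all_boot all_order all_algebra all_fingroup.
From mathcomp Require Import finmap.
From mathcomp Require Import mpoly.

Set Implicit Arguments.
Unset Strict Implicit.
Unset Printing Implicit Defensive.

Import GRing.Theory.
Local Open Scope ring_scope.
Local Open Scope fset_scope.

(* The minimum of a nonempty sequence; the value on [::] is the junk value 0. *)
Definition seq_min (s : seq nat) : nat := \big[minn/head 0%N s]_(x <- s) x.

Section ToricCode.
Variables (F : finFieldType) (r : nat).

(* Lattice points with nonnegative coordinates are multinomials 'X_{1..r};
   the cube is [0, q-2]^r with q = #|F| (so that #|F| - 2 is never truncated). *)
Definition in_cube (A : {fset 'X_{1..r}}) : Prop :=
  forall a, a \in A -> forall i : 'I_r, (a i <= #|F| - 2)%N.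

Definition torus : finType := {ffun 'I_r -> {unit F}}.

Definition word : finType := {ffun torus -> F}.

Definition evaluation (f : {mpoly F[r]}) : word :=
  [ffun p : torus => f.@[fun i => val (p i)]].

Definition lin_comb (A : {fset 'X_{1..r}}) (c : {ffun A -> F}) : {mpoly F[r]} :=
  \sum_(a : A) c a *: 'X_[val a].

(* L(A) is the set of all lin_comb c, so this is the image of L(A). *)
Definition toric_code (A : {fset 'X_{1..r}}) : {set word} :=
  [set evaluation (lin_comb c) | c : {ffun A -> F}].

Definition weight (w : word) : nat := #|[set p : torus | w p != 0]|.

Definition min_dist (A : {fset 'X_{1..r}}) : nat :=
  seq_min [seq weight w | w in [set w in toric_code A | w != [ffun=> 0]]].

End ToricCode.

Section Projection.
Variables (m : nat) (J : {set 'I_m}).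

(* The projection onto the coordinate subspace spanned by the e_j, j \in J,
   identified with R^#|J| by listing the elements of J increasingly. *)
Definition proj (b : 'X_{1..m}) : 'X_{1..#|J|} :=
  [multinom b (enum_val i) | i < #|J|].

Definition proj_set (S : {fset 'X_{1..m}}) : {fset 'X_{1..#|J|}} :=
  [fset proj b | b in S].

End Projection.

(* The fiber of S over a, with the coordinates in J dropped. *)
Definition fiber (m : nat) (J : {set 'I_m}) (S : {fset 'X_{1..m}})
    (a : 'X_{1..#|J|}) : {fset 'X_{1..#|~: J|}} :=
  proj_set (~: J) [fset b in S | proj J b == a].

(* Main.v *)
(* Write a minimum weight codeword of C_S as the evaluation of
   f = sum_a t_Y^a f_a, with f_a in L(S_a) a polynomial in the coordinates
   outside Y, and let S' be the set of those a for which f_a is not zero.  For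
   any a in S', f_a does not vanish at d(S_a) or more points u, and for each such
   u the polynomial f(., u) of L(S') has a nonzero coefficient, hence at least
   d(S') points of nonvanishing: evaluation is injective on the cube. *)
Require Import Defs.
From mathcomp Require Import all_boot all_order all_algebra all_fingroup.
From mathcomp Require Import finmap.
From mathcomp Require Import mpoly.
From mathcomp Require Import cyclic.

Set Implicit Arguments.
Unset Strict Implicit.
Unset Printing Implicit Defensive.
Import GRing.Theory.

Local Open Scope fset_scope.

Section SeqMin.
Implicit Types (s : seq nat) (x z : nat).

Lemma seq_min_le s x : x \in s -> seq_min s <= x.
Proof.
rewrite /seq_min; move: (head _ s) => z.
elim: s => //= y s IHs; rewrite inE big_cons geq_min.
by case/predU1P => [<-|/IHs ->]; rewrite ?leqnn ?orbT.
Qed.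

Lemma seq_min_mem s : s != [::] -> seq_min s \in s.
Proof.
move=> s_n0; have mem_min z : \big[minn/z]_(x <- s) x \in z :: s.
  elim: s {s_n0} => [|y s IHs]; first by rewrite big_nil inE.
  rewrite big_cons /minn !inE; case: ifP => _; rewrite ?eqxx ?orbT //.
  by move: IHs; rewrite inE => /orP[] ->; rewrite ?orbT.
(* The fold is seeded with the head of the list, so the extra candidate [z] is already a member. *)
by case: s s_n0 mem_min => // y s _ /(_ y); rewrite /seq_min /= !inE orbA orbb.
Qed.

End SeqMin.

Section Codes.
Variable F : finFieldType.
Local Open Scope ring_scope.

Definition monom r (a : 'X_{1..r}) (p : torus F r) : F :=
  \prod_(i < r) val (p i) ^+ a i.

(** Taking coefficients as a total function on exponents lets one family serve several sets of
    exponents, with no transport between subtypes. *)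
Lemma toric_codeP r (A : {fset 'X_{1..r}}) (w : word F r) :
  reflect (exists c : 'X_{1..r} -> F,
             forall p, w p = \sum_(a <- A) c a * monom a p)
          (w \in toric_code F A).
Proof.
have evalE (c : {ffun A -> F}) p :
  evaluation (lin_comb c) p = \sum_(a : A) c a * monom (val a) p.
  rewrite ffunE raddf_sum /=.
  by apply: eq_bigr => a _; rewrite mevalZ mevalX.
apply: (iffP imsetP) => [[c _ ->]|[c wE]].
  exists (fun a => if insub a is Some a' then c a' else 0) => p.
  by rewrite evalE big_seq_fsetE /=; apply: eq_bigr => a _; rewrite valK.
exists [ffun a : A => c (val a)] => //; apply/ffunP => p.
rewrite evalE wE big_seq_fsetE /=.
by apply: eq_bigr => a _; rewrite ffunE.
Qed.

Lemma weightE r (w : word F r) : weight w = (\sum_p (w p != 0%R))%N.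
Proof. by rewrite /weight -sum1dep_card big_mkcond. Qed.

Lemma neq_word0P r (w : word F r) :
  reflect (exists p, w p != 0) (w != [ffun=> 0]).
Proof.
apply: (iffP idP) => [|[p]]; last by apply: contraNneq => ->; rewrite ffunE.
move=> w0; apply/existsP; apply: contraR w0; rewrite negb_exists => /forallP w0.
by apply/eqP/ffunP => p; apply/eqP; rewrite ffunE; move: (w0 p); rewrite negbK.
Qed.

Lemma min_dist_le r (A : {fset 'X_{1..r}}) (w : word F r) :
  w \in toric_code F A -> w != [ffun=> 0] -> (min_dist F A <= weight w)%N.
Proof.
move=> wA w0; apply: seq_min_le; apply/imageP; exists w => //.
by rewrite inE wA.
Qed.

(** Any monomial with exponent in [A] takes the value 1 at the identity of the torus, so nonzero
    codewords exist and the minimum is not the junk value. *)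
Lemma min_dist_attained r (A : {fset 'X_{1..r}}) : A != fset0 ->
  exists w, [/\ w \in toric_code F A, w != [ffun=> 0] & min_dist F A = weight w].
Proof.
case/fset0Pn => a aA.
pose w : word F r := [ffun p => monom a p].
have wA : w \in toric_code F A.
  apply/toric_codeP; exists (fun b => (b == a)%:R) => p.
  rewrite (big_fsetD1 a aA) /= eqxx mul1r ffunE big_seq big1 ?addr0 // => b.
  by rewrite in_fsetD1 => /andP[/negPf-> _]; rewrite mul0r.
have w0 : w != [ffun=> 0].
  apply/neq_word0P; exists [ffun=> 1%g]; rewrite ffunE /monom big1 ?oner_neq0 //.
  by move=> i _; rewrite ffunE /= expr1n.
have /seq_min_mem/imageP[v] :
    [seq weight w | w in [set w in toric_code F A | w != [ffun=> 0]]] != [::].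
  rewrite -size_eq0 size_map -cardE cards_eq0; apply/set0Pn; exists w.
  by rewrite inE wA.
by rewrite inE => /andP[vA v0 vE]; exists v.
Qed.

(** Orthogonality of the characters of the group of units: with both exponents at most q-2, distinct
    exponents give distinct characters, while equal ones give q-1 = -1. *)
Lemma sum_units_pow (k l : nat) : (k <= #|F| - 2)%N -> (l <= #|F| - 2)%N ->
  \sum_(x : {unit F}) val x ^+ k * (val x)^-1 ^+ l = - (k == l)%:R.
Proof.
move=> kF lF; have vn0 (x : {unit F}) : val x != 0.
  by rewrite -unitfE; exact: valP.
have F1 : (1 < #|F|)%N by rewrite (cardD1 0) (cardD1 1) !inE oner_eq0.
have cardU : #|{: {unit F}}| = #|F|.-1 by rewrite -card_finField_unit cardsT.
have [<-|neq_kl] := eqVneq k l.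
  rewrite (eq_bigr (fun=> 1)) => [|x _]; last first.
    by rewrite -exprMn divff ?expr1n.
  (* The order q of the additive group of [F] kills 1. *)
  have cF0 : #|F|%:R = 0 :> F.
    by rewrite -FinRing.zmodXgE -cardsT expg_cardG ?inE.
  rewrite sumr_const cardU -subn1 natrB ?cF0 ?sub0r //.
  by rewrite (ltn_trans _ F1).
rewrite oppr0.
(* Otherwise the nonzero polynomial ['X^k - 'X^l], of degree at most q-2, would vanish at all q-1
   units. *)
have [g gP] : exists g : {unit F}, val g ^+ k != val g ^+ l.
  apply/existsP; apply: contraT; rewrite negb_exists => /forallP eq_pow.
  pose P : {poly F} := 'X^k - 'X^l.
  have P0 : P != 0.
    apply/eqP => /(congr1 (fun Q : {poly F} => Q`_k)).
    rewrite coefB !coefXn coef0 eqxx (negPf neq_kl) subr0.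
    by apply/eqP/oner_neq0.
  have /max_poly_roots := P0 => /(_ [seq val x | x : {unit F}]).
  rewrite size_map -cardE cardU map_inj_uniq ?enum_uniq; last exact: val_inj.
  case/(_ _ isT)/idPn.
    apply/allP => _ /mapP[x _ ->]; move: (eq_pow x); rewrite negbK => /eqP.
    by rewrite rootE !hornerE => ->; rewrite subrr.
  rewrite -leqNgt (leq_trans (size_polyD _ _)) // size_polyN !size_polyXn.
  by rewrite geq_max; case: #|F| F1 kF lF => [|[|n]] //= _;
    rewrite subn2 !ltnS => -> ->.
set s := \sum_x _.
(* Multiplication by [g] permutes the units; since the factor it brings out is not 1, [s] must be
   0. *)
have gs : val g ^+ k * (val g)^-1 ^+ l * s = s.
  rewrite mulr_sumr [RHS](reindex_inj (mulgI g)) /=.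
  apply: eq_bigr => x _; rewrite invfM !exprMn.
  by rewrite mulrACA.
apply/eqP; apply: contraNT gP => s0.
have /(mulIf s0)/eqP : val g ^+ k * (val g)^-1 ^+ l * s = 1 * s by rewrite gs mul1r.
by rewrite exprVn -subr_eq0 -[1](divff (expf_neq0 l (vn0 g))) -mulrBl mulf_eq0
  invr_eq0 (negPf (expf_neq0 l (vn0 g))) orbF subr_eq0.
Qed.

(* The coefficient of [t^a] in f is [(-1)^r] times the sum of [f p * p^(-a)]
   over the torus. *)
Lemma monom_free r (A : {fset 'X_{1..r}}) (c : 'X_{1..r} -> F) :
    in_cube F A -> (forall p, \sum_(a <- A) c a * monom a p = 0) ->
  {in A, forall a, c a = 0}.
Proof.
move=> cubeA f0 a aA.
have orth b : b \in A ->
  \sum_(p : torus F r) monom b p * \prod_i (val (p i))^-1 ^+ a i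
  = (-1) ^+ r * (b == a)%:R.
  move=> bA; under eq_bigr do rewrite -big_split /=.
  (* The sum over the torus factors into one sum over the units per coordinate. *)
  rewrite -(bigA_distr_bigA (fun i (x : {unit F}) => val x ^+ b i * (val x)^-1 ^+ a i)).
  under eq_bigr do rewrite sum_units_pow ?cubeA // -mulN1r.
  rewrite big_split /= prodr_const card_ord; congr (_ * _).
  have [->|neq_ba] := eqVneq b a; first by rewrite big1 // => i _; rewrite eqxx.
  have /existsP[i bai] : [exists i, b i != a i].
    apply: contraR neq_ba; rewrite negb_exists => /forallP eq_ba.
    by apply/eqP/mnmP => i; apply/eqP; move: (eq_ba i); rewrite negbK.
  by rewrite (bigD1 i) //= (negPf bai) mul0r.
have : \sum_(p : torus F r) (\sum_(b <- A) c b * monom b p) *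
         \prod_i (val (p i))^-1 ^+ a i = 0.
  by rewrite big1 // => p _; rewrite f0 mul0r.
under eq_bigr do rewrite mulr_suml.
rewrite exchange_big /= (big_fsetD1 a aA) /=.
under eq_bigr do rewrite -mulrA.
rewrite -mulr_sumr orth // eqxx mulr1 big_seq big1 => [|b]; last first.
  rewrite in_fsetD1 => /andP[neq_ba bA].
  under eq_bigr do rewrite -mulrA.
  by rewrite -mulr_sumr orth // (negPf neq_ba) !mulr0.
by rewrite addr0 => /eqP; rewrite mulf_eq0 signr_eq0 orbF => /eqP.
Qed.

Section Restriction.
Variable m : nat.
Implicit Types (J : {set 'I_m}) (S : {fset 'X_{1..m}}).

Definition restr J (p : torus F m) : torus F #|J| :=
  [ffun i => p (enum_val i)].

Lemma monom_restr J b p :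
  monom b p = monom (proj J b) (restr J p) * monom (proj (~: J) b) (restr (~: J) p).
Proof.
rewrite /monom (bigID (mem J)) /=; congr (_ * _).
  by rewrite big_enum_val; apply: eq_bigr => i _; rewrite ffunE mnmE.
rewrite (eq_bigl (mem (~: J))) => [|i]; last by rewrite !inE.
by rewrite big_enum_val; apply: eq_bigr => i _; rewrite ffunE mnmE.
Qed.

(** The coordinates inside and outside [J] determine a point, and both sides have the same
    cardinality. This allows a weight to be counted slice by slice. *)
Lemma restr_bij J : bijective (fun p => (restr J p, restr (~: J) p)).
Proof.
have restrK K p p' : restr K p = restr K p' -> {in K, p =1 p'}.
  move=> eq_pp' j jK; have /ffunP/(_ (enum_rank_in jK j)) := eq_pp'.
  by rewrite !ffunE enum_rankK_in.
apply: inj_card_bij => [p p' [eqJ eqJC]|].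
  apply/ffunP => j; have [jJ|jJ] := boolP (j \in J).
    exact: (restrK _ _ _ eqJ).
  by apply: (restrK _ _ _ eqJC); rewrite inE.
by rewrite card_prod !card_ffun !card_ord -expnD cardsC card_ord.
Qed.

Lemma in_cube_proj J S : in_cube F S -> in_cube F (proj_set J S).
Proof.
by move=> cubeS _ /imfsetP[b bS ->] i; rewrite mnmE cubeS.
Qed.

Lemma sub_in_cube r (A B : {fset 'X_{1..r}}) :
  A `<=` B -> in_cube F B -> in_cube F A.
Proof. by move=> /fsubsetP AB cubeB a /AB; apply: cubeB. Qed.

End Restriction.

End Codes.

Theorem theorem3p1 (F : finFieldType) (m : nat) (hm : (1 <= m)%N)
    (S : {fset 'X_{1..m}}) (hS0 : S != fset0) (hS : in_cube F S)
    (J : {set 'I_m}) :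
  (seq_min [seq (min_dist F S' * \max_(a <- S') min_dist F (fiber S a))%N
           | S' <- fpowerset (proj_set J S) & S' != fset0]
   <= min_dist F S)%N.
Proof.
have [w [/toric_codeP[c wE] w0 ->]] := min_dist_attained F hS0.
(* The word of f_a. *)
pose g (a : 'X_{1..#|J|}) : word F #|~: J| :=
  [ffun u => \sum_(b <- S | proj J b == a) c b * monom (proj (~: J) b) u]%R.
have gP a : g a \in toric_code F (fiber S a).
  apply/toric_codeP.
  (* At most one [b] has both projections prescribed; summing over all such [b] avoids having to
     choose it. *)
  exists (fun e =>
    \sum_(b <- S | (proj J b == a) && (proj (~: J) b == e)) c b)%R => u.
  rewrite ffunE big_fset_condE /= /fiber /proj_set.
  rewrite (partition_big_imfset _ (proj (~: J))) /=.
  apply: eq_bigr => e _.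
  rewrite mulr_suml big_mkcond -big_fset_condE /= [RHS]big_mkcondr.
  by apply: eq_bigr => b _; case: eqP => // ->.
have wgE p : (w p = \sum_(a <- proj_set J S) monom a (restr J p) * g a (restr (~: J) p))%R.
  rewrite wE (partition_big_imfset _ (proj J)) /=.
  apply: eq_bigr => a _; rewrite ffunE mulr_sumr; apply: eq_bigr => b /eqP <-.
  by rewrite (monom_restr J) mulrCA.
pose S' := [fset a in proj_set J S | g a != [ffun=> 0%R]].
have S'S : S' `<=` proj_set J S by apply/fsubsetP => a; rewrite !inE => /andP[].
have wS' p : (w p = \sum_(a <- S') g a (restr (~: J) p) * monom a (restr J p))%R.
  rewrite wgE -big_fset_condE /= [RHS]big_mkcond; apply: eq_bigr => a _.
  by case: eqP => [->|_]; rewrite mulrC // ffunE mul0r.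
have S'0 : S' != fset0.
  apply: contra_neq w0 => S'0; apply/ffunP => p.
  by rewrite wS' S'0 big_seq_fset0 ffunE.
apply: leq_trans (_ : min_dist F S' * \max_(a <- S') min_dist F (fiber S a) <= _).
  by apply/seq_min_le/map_f; rewrite mem_filter S'0 fpowersetE.
(* With the factor moved inside the maximum, each [a] in [S'] can be treated separately. *)
rewrite (big_morph _ (maxnMr _) (muln0 _)).
apply/bigmax_leqP_seq => a aS' _.
have ga0 : g a != [ffun=> 0%R] by move: aS'; rewrite !inE => /andP[].
(* The slice of [w] at [u], whose coefficient at [a] is [g a u]; by [monom_free] it is nonzero as
   soon as one of these coefficients is. *)
pose f u : word F #|J| := [ffun v => \sum_(a <- S') g a u * monom a v]%R.
have fP u : f u \in toric_code F S'.
  by apply/toric_codeP; exists (g^~ u) => v; rewrite ffunE.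
have f0 u : g a u != 0%R -> f u != [ffun=> 0%R].
  apply: contra_neq => fu0.
  apply: (monom_free (c := g^~ u) (sub_in_cube S'S (in_cube_proj hS))) aS' => v.
  by move/ffunP/(_ v): fu0; rewrite !ffunE.
have -> : weight w = \sum_u weight (f u).
  rewrite weightE; under [RHS]eq_bigr do rewrite weightE.
  rewrite exchange_big pair_big /= (reindex _ (onW_bij _ (restr_bij F J))) /=.
  by apply: eq_bigr => p _; rewrite ffunE wS'.
(* Only the slices over the support of [g a] are counted, each with weight at least
   [min_dist F S']. *)
rewrite mulnC; apply: leq_trans (_ : weight (g a) * min_dist F S' <= _).
  by rewrite leq_mul2r (min_dist_le (gP a)) ?orbT.
rewrite weightE big_distrl; apply: leq_sum => u _.
by case: eqP => //= /eqP gu; rewrite mul1n min_dist_le ?f0.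
Qed.
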